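(* Let $G=T_1\times T_2\times\cdots\times T_r$ for some $r\ge1$, where each $T_i$ is a finite nonabelian simple group, and suppose that, for $1\le i\le r$, $T_i$ is not a section of $\prod_{j\ne i}T_j$. Then $G$ is totally $2$-closed if and only if the following two conditions hold: (a) for $i=1,\dots,r$, the group $T_i$ admits no nontrivial factorisation; and (b) for each permutation representation $\varphi:G\to\mathrm{Sym}(\Omega)$ (faithful or not) with $|\Omega|>1$ and $\varphi(G)$ transitive, we have $\varphi(G)^{(2),\Omega}=\varphi(G)$.
   Context: For a permutation group $G\le \mathrm{Sym}(\Omega)$, the $2$-closure $G^{(2),\Omega}$ is the group of all $g\in\mathrm{Sym}(\Omega)$ that leave invariant each $G$-orbit in the induced $G$-action on $\Omega\times\Omega$. A group $G$ is totally $2$-closed if $G^{(2),\Omega}=G$ whenever $G$ is faithfully represented as a permutation group on a set $\Omega$. A nontrivial group $X$ is a section of a group $G$ if there are subgroups $L\unlhd H\le G$ with $H/L\cong X$. A nontrivial factorisation of a group $T$ is a factorisation $T=HK$ with both $H$ and $K$ proper subgroups of $T$. *)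

(* Defs.v *)
From HB Require Import structures.
From mathcomp Require Import all_boot all_fingroup all_solvable.
From mathcomp Require Import boolp classical_sets.

Set Implicit Arguments.
Unset Strict Implicit.
Unset Printing Implicit Defensive.

Local Open Scope classical_set_scope.
Local Open Scope group_scope.

(* MathComp's {perm T} and actions on finTypes would force the set acted on to
   be finite.  Here Omega is an arbitrary type, an element of Sym(Omega) is a
   bijective function Omega -> Omega, and a permutation group on Omega is a
   set of such functions. *)

Section PermutationGroups.
Variable Omega : Type.
Implicit Types (A : set (Omega -> Omega)) (g : Omega -> Omega).
Implicit Types p : Omega * Omega.

Definition pair_act g p : Omega * Omega := (g p.1, g p.2).

Definition orbit_on_pairs A p : set (Omega * Omega) :=
  (fun g => pair_act g p) @` A.

Definition two_closure A : set (Omega -> Omega) :=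
  [set g | bijective g /\
     forall p, pair_act g @` orbit_on_pairs A p = orbit_on_pairs A p].

Definition transitive_on A : Prop :=
  forall a b : Omega, exists2 g, A g & g a = b.

End PermutationGroups.

Section GroupNotions.
Variable gT : finGroupType.

(* As for {perm T}, products in Sym(Omega) are read from left to right.  The
   values of phi outside of G are irrelevant. *)
Definition perm_rep (G : {group gT}) (Omega : Type)
    (phi : gT -> Omega -> Omega) : Prop :=
  {in G, forall x, bijective (phi x)} /\
  {in G &, forall x y, phi (x * y) = phi y \o phi x}.

Definition rep_image (G : {group gT}) (Omega : Type)
    (phi : gT -> Omega -> Omega) : set (Omega -> Omega) :=
  phi @` [set` G].

Definition totally_two_closed (G : {group gT}) : Prop :=
  forall (Omega : Type) (phi : gT -> Omega -> Omega),
    perm_rep G phi -> {in G &, injective phi} ->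
    two_closure (rep_image G phi) = rep_image G phi.

Definition has_nontrivial_factorisation (T : {group gT}) : Prop :=
  exists H K : {group gT}, [/\ H \proper T, K \proper T & T :=: H * K].

(* A is a mere set so that it may be a \big[dprod/1] expression. *)
Definition is_section_of (rT : finGroupType) (X : {group rT})
    (A : {set gT}) : Prop :=
  X :!=: 1 /\
  exists L H : {group gT}, [/\ L <| H, H \subset A & H / L \isog X].

End GroupNotions.

(* Main.v *)
Require Import Defs.
From HB Require Import structures.
From mathcomp Require Import boolp classical_sets.
From mathcomp Require Import all_boot all_fingroup all_solvable.

Set Implicit Arguments.
Unset Strict Implicit.
Unset Printing Implicit Defensive.

Local Open Scope group_scope.

(** A normal subgroup N of G contains T_i or centralises it, so G = N x C_G(N).

    If T_i = HK is a nontrivial factorisation and M = C_G(T_i), let G act on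
    G/HM, G/KM and G/T_i; this is faithful.  As G = (HM)(KM) is transitive on
    G/HM x G/KM, the action of t in T_i on the first orbit alone lies in the
    2-closure, but only for t = 1 is it induced by G.  An arbitrary
    representation with kernel N becomes faithful after adding G/C_G(N), and its
    2-closure extends by the identity on the new points.

    Conversely, let h be in the 2-closure.  By (b), h agrees on the orbit of each
    point a with some g_a in G.  For points a, b with stabilisers A, B, the
    element g_a g_b^-1 lies in every product A^u B^v.  The elements with this
    property form a normal subgroup, so if g_a g_b^-1 does not centralise T_i,
    then T_i lies in AB.  When neither A nor B contains T_i, this is impossible:
    by (a) one of them, say A, projects onto T_i, hence meets T_i trivially and
    embeds in C_G(T_i), which makes T_i a section of the other factors.  So the
    g_a have compatible components and glue to one element of G. *)

(** * Products of subgroups against a simple direct factor *)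

Section DirectFactor.
Variables (gT : finGroupType) (G T M : {group gT}).
Hypotheses (defG : T \x M = G) (simT : simple T).

Lemma direct_factor_normal : T <| G /\ M <| G.
Proof.
case/dprodP: defG => _ <- cTM _; split; apply/andP; split.
- exact: mulG_subl.
- by rewrite mulG_subG normG cents_norm.
- exact: mulG_subr.
- by rewrite mulG_subG normG cents_norm // centsC.
Qed.

(** [(A <*> M) :&: T] is the projection of [A] to [T] along [M]. When [t = a * b], the
    [M]-components of [a] and [b] multiply to an element of [T :&: M], so they cancel. *)
Lemma product_factorisation (A B : {group gT}) :
  A \subset G -> B \subset G -> T \subset A * B ->
  T :=: ((A <*> M) :&: T) * ((B <*> M) :&: T).
Proof.
case/dprodP: defG => _ eG cTM tiTM sAG sBG sTAB.
have [_ /andP[_ nMG]] := direct_factor_normal.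
have proj (C : {group gT}) c : C \subset G -> c \in C ->
    exists t m, [/\ t \in (C <*> M) :&: T, m \in M & c = t * m].
  move=> sCG Cc; have: c \in T * M by rewrite eG (subsetP sCG).
  case/mulsgP=> t m Tt Mm ec; exists t, m; split=> //.
  rewrite inE Tt andbT -(mulgK m t) -ec groupM //.
    by rewrite (subsetP (joing_subl _ _)).
  by rewrite groupV (subsetP (joing_subr _ _)).
apply/eqP; rewrite eqEsubset mul_subG ?subsetIr // andbT.
apply/subsetP=> t Tt; have /mulsgP[a b Aa Bb et] := subsetP sTAB t Tt.
have [t1 [m1 [t1P Mm1 ea]]] := proj A a sAG Aa.
have [t2 [m2 [t2P Mm2 eb]]] := proj B b sBG Bb.
have [/setIP[_ Tt1] /setIP[_ Tt2]] := (t1P, t2P).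
have e12 : t = t1 * t2 * (m1 * m2).
  have cmt : commute m1 t2.
    exact: (centP (subsetP cTM m1 Mm1) t2 Tt2).
  by rewrite et ea eb !mulgA -(mulgA t1 t2) -cmt !mulgA.
suff m12 : m1 * m2 = 1 by rewrite e12 m12 mulg1 mem_mulg.
apply/set1gP; rewrite -tiTM inE (groupM Mm1 Mm2) andbT.
by rewrite -(mulKg (t1 * t2) (m1 * m2)) -e12 !groupM ?groupV ?groupM.
Qed.

(* A subgroup that projects onto [T] but does not contain [T] meets [T]
   trivially, so it embeds in [M] and keeps its quotient [T]. *)
Lemma covering_subgroup_section (A : {group gT}) :
  A \subset G -> T \subset A <*> M -> ~~ (T \subset A) -> is_section_of T M.
Proof.
move=> sAG sTAM nsTA.
have [nsTG nsMG] := direct_factor_normal.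
have [/andP[sTG nTG] /andP[sMG nMG]] := (nsTG, nsMG).
case/dprodP: defG => _ eG cTM tiTM.
have nTA := subset_trans sAG nTG; have nMA := subset_trans sAG nMG.
have eAM : A * M = G.
  apply/eqP; rewrite eqEsubset mul_subG //= -eG.
  by rewrite -(norm_joinEl nMA) mul_subG ?joing_subr.
(* The intersection is normalised by [A] and centralised by [M], hence normal in [T], which lies in
   [A <*> M]. *)
have tiAT : A :&: T = 1.
  have nsAT : A :&: T <| T.
    rewrite /normal subsetIr (subset_trans sTAM) // join_subG normsI ?normG //=.
    by rewrite cents_norm // (centsS (subsetIr _ _)).
  case/simpleP: simT => _ /(_ _ nsAT)[] // eAT.
  by case/negP: nsTA; rewrite -eAT subsetIl.
split; first by case/simpleP: simT.
(* [Q] is the projection of [A] to [M], and [Q / D] is the required section. The second isomorphism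
   theorem modulo [E] identifies it with [A / D], and modulo [M] identifies [A / D] with [G / M], a
   copy of [T]. *)
pose D := (A :&: M)%G; pose Q := ((A <*> T) :&: M)%G; pose E := (D <*> T)%G.
have sDG : D \subset G by rewrite subIset ?sAG.
have nTD := subset_trans sDG nTG.
have eE : E = D * T :> {set gT} by rewrite /= (norm_joinEl nTD).
have sQG : Q \subset G by rewrite subIset // sMG orbT.
have nDT : T \subset 'N(D).
  by rewrite cents_norm // (centsS (subsetIr _ _)) // centsC.
have nDA : A \subset 'N(D) by rewrite normsI ?normG.
have nEA : A \subset 'N(E) by rewrite normsY.
have nDQ : Q \subset 'N(D) by rewrite subIset // join_subG nDA nDT.
have nEQ : Q \subset 'N(E) by rewrite normsY // (subset_trans sQG).
have eEA : E :&: A = D.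
  by rewrite eE -group_modl ?subsetIl // setIC tiAT mulg1.
have sDQ : D \subset Q by rewrite setSI ?joing_subl.
have eEQ : E :&: Q = D.
  rewrite eE -group_modl // setIA.
  suff ->: T :&: (A <*> T) :&: M = 1 by rewrite mulg1.
  by apply/trivgP; rewrite -tiTM setSI ?subsetIl.
have eAE : A * E = Q * E.
  rewrite eE !mulgA (mulGSid (subsetIl A M)) (mulGSid sDQ) -(norm_joinEl nTA).
  have ->: Q * T = (A <*> T) :&: (M * T).
    by rewrite group_modr ?joing_subr.
  by rewrite (centC cTM) eG; apply/esym/setIidPl; rewrite join_subG sAG sTG.
exists D, Q; split; rewrite ?subsetIr //; first by apply/andP.
have i1 : A / D \isog A / E by have := second_isog nEA; rewrite eEA.
have i2 : Q / D \isog A / E.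
  by have := second_isog nEQ; rewrite eEQ -(quotientMidr E A) eAE quotientMidr.
have i3 : A / D \isog G / M.
  by have := second_isog nMA; rewrite setIC -eAM quotientMidr.
have i4 : T \isog G / M.
  rewrite -eG quotientMidr; have := second_isog (subset_trans sTG nMG).
  by rewrite setIC tiTM; apply: isog_trans; apply: quotient1_isog.
apply: (isog_trans i2); apply: isog_symr; apply: (isog_trans i4).
by apply: isog_symr; apply: isog_trans (isog_symr i1) i3.
Qed.

(** If neither subgroup contains [T], then one projecting onto [T] would make [T] a section of [M],
    and two proper projections would factorise [T]. *)
Lemma no_product_cover (A B : {group gT}) :
  ~ has_nontrivial_factorisation T -> ~ is_section_of T M ->
  A \subset G -> B \subset G -> T \subset A * B ->
  (T \subset A) || (T \subset B).
Proof.
move=> nfT nsT sAG sBG sTAB; apply/negPn/negP; rewrite negb_or => /andP[nA nB].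
have [fA|fA] := boolP (T \subset A <*> M).
  by case: nsT; apply: covering_subgroup_section fA nA.
have [fB|fB] := boolP (T \subset B <*> M).
  by case: nsT; apply: covering_subgroup_section fB nB.
apply: nfT; exists ((A <*> M) :&: T)%G, ((B <*> M) :&: T)%G; split.
- by rewrite properE subsetIr subsetI subxx andbT.
- by rewrite properE subsetIr subsetI subxx andbT.
- exact: product_factorisation.
Qed.

End DirectFactor.

(** * Direct products of nonabelian simple groups *)

Section SemisimpleGroup.
Variables (gT : finGroupType) (r : nat) (G : {group gT}) (T : 'I_r -> {group gT}).
Hypotheses (G_dprod : \big[dprod/1]_(i < r) T i = G)
  (T_simple : forall i, simple (T i)) (T_nonabelian : forall i, ~~ abelian (T i)).

Lemma simple_nonabelian_center (H : {group gT}) :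
  simple H -> ~~ abelian H -> 'Z(H) = 1.
Proof.
case/simpleP=> _ /(_ _ (center_normal H))[] // eZ /negP[].
by apply/center_idP.
Qed.

(** The other factors centralise [T i], and ['C_G(T i)] is no larger because [T i] has trivial
    centre. *)
Lemma bigdprod_cofactor i :
  \big[dprod/1]_(j < r | j != i) T j = 'C_G(T i) /\ T i \x 'C_G(T i) = G.
Proof.
have := G_dprod; rewrite (bigD1 i) //= => defG.
case/dprodP: (defG) => [[_ M _ eM]]; rewrite eM => eG cTM tiTM.
suff eC : M = 'C_G(T i) :> {set gT} by rewrite -eC -eM.
apply/eqP; rewrite eqEsubset subsetI cTM -eG mulG_subr /=.
rewrite setIC -group_modr // setIC -/('Z(T i)) simple_nonabelian_center //.
by rewrite mul1g.
Qed.

Lemma factor_normal i : T i <| G.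
Proof. by have [_ /direct_factor_normal[]] := bigdprod_cofactor i. Qed.

Lemma factors_generate (H : {group gT}) :
  (forall i, T i \subset H) -> G \subset H.
Proof.
move=> sTH; rewrite -(bigdprodW G_dprod).
by apply: (big_ind (fun A : {set gT} => A \subset H)) => [|A B|i _];
  [exact: sub1G | exact: mul_subG | exact: sTH].
Qed.

Lemma factors_centralise i j : j != i -> T j \subset 'C(T i).
Proof.
move=> ji; have [eC _] := bigdprod_cofactor i.
suff : T j \subset 'C_G(T i) by rewrite subsetI => /andP[].
have /= <- := bigdprodWY eC; by rewrite sub_gen // (bigcup_max j).
Qed.

Lemma centralise_factors_eq1 x : x \in G -> (forall i, x \in 'C(T i)) -> x = 1.
Proof.
move=> Gx cx; have : x \in 'Z(G).
  rewrite inE Gx -sub_cent1; apply: (@factors_generate 'C[x]) => i.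
  by rewrite sub_cent1.
rewrite -(center_bigdprod G_dprod) big1 => [/set1gP // | i _].
exact: simple_nonabelian_center.
Qed.

(** By simplicity [N :&: T i] is [T i] or trivial; in the latter case it contains the commutators of
    [N] with [T i]. *)
Lemma normal_factor_dichotomy (N : {group gT}) i :
  N <| G -> (T i \subset N) || (N \subset 'C(T i)).
Proof.
case/andP=> sNG nNG; have /andP[sTG nTG] := factor_normal i.
have nsI : N :&: T i <| T i.
  by rewrite /normal subsetIr normsI ?normG // (subset_trans sTG).
case/simpleP: (T_simple i) => _ /(_ _ nsI)[] eI.
  apply/orP; right; apply/commG1P/trivgP; rewrite -eI subsetI.
  by rewrite commg_subl commg_subr (subset_trans sTG) // (subset_trans sNG).
by rewrite -eI subsetIl.
Qed.

(** By the dichotomy every factor lies in [N] or in its centraliser, so the two generate [G]; an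
    element of both centralises every factor. *)
Lemma normal_dprod_cent (N : {group gT}) : N <| G -> N \x 'C_G(N) = G.
Proof.
move=> nsN; have [sNG nNG] := andP nsN.
have nNC : 'C_G(N) \subset 'N(N) by rewrite subIset ?nNG.
have tiNC : N :&: 'C_G(N) = 1.
  apply/trivgP/subsetP=> x /setIP[Nx /setIP[Gx cNx]]; apply/set1gP.
  apply: centralise_factors_eq1 => // i.
  case/orP: (normal_factor_dichotomy i nsN) => [sTN | cNT].
    exact: subsetP (centS sTN) x cNx.
  exact: subsetP cNT x Nx.
rewrite dprodE ?subsetIr //.
apply/eqP; rewrite eqEsubset mul_subG ?subsetIl //= -(norm_joinEr nNC).
apply: factors_generate => i.
case/orP: (normal_factor_dichotomy i nsN) => [sTN | cNT].
  by rewrite (subset_trans sTN) ?joing_subl.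
rewrite (subset_trans _ (joing_subr _ _)) // subsetI centsC cNT andbT.
by case/andP: (factor_normal i).
Qed.

(** The component of [y] in ['C_G(N)] centralises the factors inside [N], and also the others, since
    both [y] and [N] do. *)
Lemma mem_normal_by_factors (N : {group gT}) y :
  N <| G -> y \in G -> (forall i, ~~ (T i \subset N) -> y \in 'C(T i)) ->
  y \in N.
Proof.
move=> nsN Gy cy; have /dprodP[_ eG _ _] := normal_dprod_cent nsN.
move: (Gy); rewrite -eG => /mulsgP[n c Nn /setIP[Gc cNc] ey].
suff c1 : c = 1 by rewrite ey c1 mulg1.
apply: centralise_factors_eq1 => // i.
have [sTN | nsTN] := boolP (T i \subset N).
  exact: subsetP (centS sTN) c cNc.
have := normal_factor_dichotomy i nsN; rewrite (negPf nsTN) => cNT.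
by rewrite -(mulKg n c) -ey groupM ?groupV ?cy // (subsetP cNT).
Qed.

(** The condition says that [g] and [c i] have the same component in [T i]. Left multiplication by
    an element of [T i] corrects that component and leaves the others alone, which gives an
    induction over the indices. *)
Lemma glue_components (c : 'I_r -> gT) : (forall i, c i \in G) ->
  exists2 g, g \in G & forall i, g * (c i)^-1 \in 'C(T i).
Proof.
move=> Gc.
suff [g Gg gP] : exists2 g, g \in G &
    forall i, i \in enum 'I_r -> g * (c i)^-1 \in 'C(T i).
  by exists g => // i; rewrite gP ?mem_enum.
elim: (enum 'I_r) => [|i s [g Gg gP]]; first by exists 1.
have [is_ | nis] := boolP (i \in s).
  by exists g => // j; rewrite inE => /predU1P[-> | /gP//]; apply: gP.
have [_ /dprodP[_ eG _ _]] := bigdprod_cofactor i.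
have [sTG _] := andP (factor_normal i).
have : c i * g^-1 \in T i * 'C_G(T i) by rewrite eG groupM ?groupV.
case/mulsgP=> t m Tt /setIP[Gm cm] e.
exists (t * g) => [|j]; first by rewrite groupM // (subsetP sTG).
have [-> _ | ji] := eqVneq j i; last first.
  rewrite inE (negPf ji) => /gP cg; rewrite -mulgA groupM //.
  by apply: subsetP Tt; apply: factors_centralise; rewrite eq_sym.
have ->: t * g * (c i)^-1 = (m^-1) ^ t^-1.
  have -> : c i = t * m * g by rewrite -e mulgKV.
  by rewrite !invMg conjgE invgK !mulgA mulgK.
rewrite memJ_norm ?groupV //.
by rewrite (subsetP _ t Tt) // norms_cent ?normG.
Qed.

Hypotheses
  (T_nfact : forall i, ~ has_nontrivial_factorisation (T i))
  (T_nsection : forall i,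
     ~ is_section_of (T i) (\big[dprod/1]_(j < r | j != i) T j)).

(* The elements lying in all products [A^u B^v] form a normal subgroup; if one
   of them does not centralise [T i], that subgroup contains [T i]. *)
Lemma mem_all_conj_products (A B : {group gT}) i x :
  A \subset G -> B \subset G -> ~~ (T i \subset A) -> ~~ (T i \subset B) ->
  x \in G -> (forall u v, u \in G -> v \in G -> x \in A :^ u * B :^ v) ->
  x \in 'C(T i).
Proof.
move=> sAG sBG nA nB Gx xP.
pose X := [set x in G | [forall u in G, forall v in G, x \in A :^ u * B :^ v]].
have XP y : reflect (y \in G /\ forall u v, u \in G -> v \in G ->
    y \in A :^ u * B :^ v) (y \in X).
  rewrite inE; apply: (iffP andP) => -[Gy yP]; split=> //.
    by move=> u v Gu Gv; move/forall_inP: yP => /(_ u Gu)/forall_inP/(_ v Gv).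
  by apply/forall_inP=> u Gu; apply/forall_inP=> v Gv; apply: yP.
have gX : group_set X.
  apply/group_setP; split=> [|y z /XP[Gy yP] /XP[Gz zP]].
    by apply/XP; split=> // u v _ _; rewrite -[1]mulg1 mem_mulg ?group1.
  apply/XP; split=> [|u v Gu Gv]; first exact: groupM.
  have /mulsgP[a b Aa Bb ey] := yP u v Gu Gv.
  (* The conjugate by [u * y] is chosen so that moving [y] past [a'] brings [a'] back into
     [A :^ u]. *)
  have /mulsgP[a' b' Aa' Bb' ez] := zP (u * y) v (groupM Gu Gy) Gv.
  have -> : y * z = (a' ^ y^-1 * a) * (b * b').
    by rewrite conjgE invgK -!mulgA (mulgA a) -ey mulKg -ez.
  apply: mem_mulg; last exact: groupM.
  by apply: groupM => //; rewrite -mem_conjg -conjsgM.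
have nsX : Group gX <| G.
  apply/andP; split; first by apply/subsetP=> y /XP[].
  apply/subsetP=> z Gz; rewrite inE; apply/subsetP=> _ /imsetP[y /XP[Gy yP] ->].
  apply/XP; split=> [|u v Gu Gv]; first exact: groupJ.
  rewrite -(mulgKV z u) -(mulgKV z v) (conjsgM A) (conjsgM B) -conjsMg memJ_conjg.
  by rewrite yP ?groupM ?groupV.
have /orP[sTX | cX] := normal_factor_dichotomy i nsX; last first.
  by rewrite (subsetP cX) //; apply/XP.
have [eC defG] := bigdprod_cofactor i.
have := @no_product_cover _ G (T i) ('C_G(T i))%G defG (T_simple i) A B.
rewrite (negPf nA) (negPf nB) => /(_ (@T_nfact i)) H.
suff: false by [].
apply: H => //; first by have := @T_nsection i; rewrite eC.
apply/subsetP=> t /(subsetP sTX)/XP[_ /(_ 1 1)].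
by rewrite !conjsg1; apply.
Qed.

End SemisimpleGroup.

(** * Two-closure, stabilisers and restriction to an orbit *)

Section PermRep.
Variables (gT : finGroupType) (G : {group gT}) (Omega : Type).
Variable phi : gT -> Omega -> Omega.
Hypothesis phiP : perm_rep G phi.

Lemma rep_mul x y a : x \in G -> y \in G -> phi (x * y) a = phi y (phi x a).
Proof. by move=> Gx Gy; rewrite (phiP.2 x y). Qed.

Lemma rep_one a : phi 1 a = a.
Proof.
have [f fK _] := phiP.1 1 (group1 G).
by apply: (can_inj fK); rewrite -rep_mul ?mulg1.
Qed.

Lemma repK x : x \in G -> cancel (phi x) (phi x^-1).
Proof. by move=> Gx a; rewrite -rep_mul ?groupV // mulgV rep_one. Qed.

Lemma repVK x : x \in G -> cancel (phi x^-1) (phi x).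
Proof. by move=> Gx a; rewrite -rep_mul ?groupV // mulVg rep_one. Qed.

Definition agrees_on_pairs (h : Omega -> Omega) :=
  forall a b, exists2 g, g \in G & h a = phi g a /\ h b = phi g b.

(** For the converse, invariance of a pair orbit is an equality of sets; the inclusion of the orbit
    in its image comes from applying the agreement to preimages under [h]. *)
Lemma two_closureE h :
  two_closure (rep_image G phi) h <-> bijective h /\ agrees_on_pairs h.
Proof.
split=> -[bij_h hP]; split=> //.
  move=> a b.
  have : orbit_on_pairs (rep_image G phi) (a, b) (pair_act h (a, b)).
    rewrite -hP; exists (a, b) => //; exists (phi 1); first by exists 1 => //=.
    by rewrite /pair_act /= !rep_one.
  by case=> _ [g /= Gg <-] [ea eb]; exists g.
move=> [a b]; rewrite classical_sets.eqEsubset; split=> q.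
  case=> _ [_ [g /= Gg <-] <-] <-; rewrite /pair_act /=.
  have [k Gk [-> ->]] := hP (phi g a) (phi g b).
  exists (phi (g * k)); first by exists (g * k) => //=; apply: groupM.
  by rewrite /pair_act /= !rep_mul.
case=> _ [g /= Gg <-] <-; rewrite /pair_act /=.
have [f fK hK] := bij_h.
have [k Gk []] := hP (f (phi g a)) (f (phi g b)).
rewrite !hK => ea eb.
exists (f (phi g a), f (phi g b)); last by rewrite /pair_act /= !hK.
exists (phi (g * k^-1)).
  by exists (g * k^-1) => //=; rewrite groupM ?groupV.
rewrite /pair_act /= !rep_mul ?groupV //.
by congr (_, _); [rewrite {1}ea | rewrite {1}eb]; apply: repK.
Qed.

Lemma two_closedE :
  two_closure (rep_image G phi) = rep_image G phi <->
  (forall h, bijective h -> agrees_on_pairs h ->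
     exists2 g, g \in G & h = phi g).
Proof.
split=> [clG h bij_h hP | clG].
  have : rep_image G phi h by rewrite -clG two_closureE.
  by case=> g /= Gg <-; exists g.
rewrite classical_sets.eqEsubset; split=> h.
  by case/two_closureE=> bij_h hP; have [g Gg ->] := clG h bij_h hP; exists g.
case=> g /= Gg <-; apply/two_closureE; split; first exact: phiP.1.
by move=> a b; exists g.
Qed.

Definition stab a : {set gT} := [set x in G | `[< phi x a = a >]].

Lemma stabP a x : reflect (x \in G /\ phi x a = a) (x \in stab a).
Proof.
by rewrite inE; apply: (iffP andP) => -[Gx /asboolP].
Qed.

Lemma stab_group_set a : group_set (stab a).
Proof.
apply/group_setP; split=> [|x y /stabP[Gx xa] /stabP[Gy ya]].
  by apply/stabP; rewrite rep_one.
by apply/stabP; rewrite groupM // rep_mul // xa ya.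
Qed.

Canonical stab_group a := Group (stab_group_set a).

Lemma stab_sub a : stab a \subset G.
Proof. by apply/subsetP=> x /stabP[]. Qed.

Lemma mem_stab_conj a u x : x \in G -> u \in G ->
  phi x (phi u a) = phi u a -> x \in stab a :^ u.
Proof.
move=> Gx Gu xu; rewrite mem_conjg; apply/stabP; split.
  by rewrite groupJ ?groupV.
by rewrite conjgE invgK !rep_mul ?groupM ?groupV // xu repK.
Qed.

Definition orbit_type a := {x : Omega | exists2 g, g \in G & phi g a = x}.

(** The default value [x] makes this total for every [f]; it is never reached when [f] moves each
    point as some element of [G] does. *)
Definition orbit_restr a (f : Omega -> Omega) (x : orbit_type a) :=
  if pselect (exists2 g, g \in G & phi g a = f (sval x)) is left p
  then exist _ (f (sval x)) p else x.

Lemma sval_orbit_restr a f (x : orbit_type a) :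
  (exists2 g, g \in G & f (sval x) = phi g (sval x)) ->
  sval (orbit_restr f x) = f (sval x).
Proof.
rewrite /orbit_restr; case: pselect => //= nx [g Gg e]; case: nx.
case: x e => _ /= [k Gk <-] ->; exists (k * g); first exact: groupM.
by rewrite rep_mul.
Qed.

Lemma orbit_type_inj a : injective (sval : orbit_type a -> Omega).
Proof.
by case=> x p [y q] /= e; rewrite -e in q *; rewrite (Prop_irrelevance p q).
Qed.

Lemma orbit_restr_bij a f :
  bijective f -> (forall x, exists2 g, g \in G & f x = phi g x) ->
  bijective (@orbit_restr a f).
Proof.
case=> k kK fK fP.
have kP x : exists2 g, g \in G & k x = phi g x.
  have [g Gg e] := fP (k x); exists g^-1; first by rewrite groupV.
  by rewrite -{2}(fK x) e repK.
exists (@orbit_restr a k) => x; apply: orbit_type_inj.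
  by rewrite !sval_orbit_restr.
by rewrite !sval_orbit_restr.
Qed.

Lemma sval_orbit_rep a g (x : orbit_type a) : g \in G ->
  sval (orbit_restr (phi g) x) = phi g (sval x).
Proof. by move=> Gg; apply: sval_orbit_restr; exists g. Qed.

Lemma orbit_rep a : perm_rep G (fun x => @orbit_restr a (phi x)).
Proof.
split=> [x Gx | x y Gx Gy].
  by apply: orbit_restr_bij; [exact: phiP.1 | move=> b; exists x].
by apply/funext=> b; apply: orbit_type_inj; rewrite /= !sval_orbit_rep ?groupM // rep_mul.
Qed.

End PermRep.

(** The restriction of [h] to the orbit of [a] lies in the 2-closure of a transitive representation,
    to which condition (b) applies. *)
Lemma agree_on_orbit (gT : finGroupType) (G : {group gT}) (Omega : Type)
    (phi : gT -> Omega -> Omega) (h : Omega -> Omega) a :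
  perm_rep G phi ->
  (forall (O : Type) (psi : gT -> O -> O), perm_rep G psi ->
     (exists b c : O, b <> c) -> transitive_on (rep_image G psi) ->
     two_closure (rep_image G psi) = rep_image G psi) ->
  bijective h -> agrees_on_pairs G phi h ->
  exists2 g, g \in G & forall u, u \in G -> h (phi u a) = phi g (phi u a).
Proof.
move=> phiP cl bij_h hP.
have h1 x : exists2 g, g \in G & h x = phi g x.
  by have [g Gg [e _]] := hP x x; exists g.
pose pt u (Gu : u \in G) : orbit_type G phi a :=
  exist _ (phi u a) (ex_intro2 _ _ u Gu erefl).
(* Condition (b) does not cover a one-point orbit, but there [h] fixes the point and [1] serves. *)
have [[b [c nbc]] | triv] := pselect (exists b c : orbit_type G phi a, b <> c);
    last first.
  exists 1 => // u Gu; rewrite (rep_one phiP).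
  have [g Gg ->] := h1 (phi u a); rewrite -(rep_mul phiP) //.
  apply: contrapT => ne; apply: triv; exists (pt _ (groupM Gu Gg)), (pt u Gu).
  by move/(congr1 sval).
have tr : transitive_on (rep_image G (fun x => @orbit_restr _ G _ phi a (phi x))).
  move=> [x [u Gu ex]] [y [v Gv ey]].
  exists (@orbit_restr _ G _ phi a (phi (u^-1 * v))).
    by exists (u^-1 * v) => //=; rewrite groupM ?groupV.
  apply: orbit_type_inj; rewrite (sval_orbit_rep phiP) ?groupM ?groupV //= -ex -ey.
  by rewrite (rep_mul phiP) ?groupV // (repK phiP).
have nontriv : exists b c : orbit_type G phi a, b <> c by exists b, c.
have /(two_closedE (orbit_rep phiP a)) clO := cl _ _ (orbit_rep phiP a) nontriv tr.
have [|x y|g Gg e] := clO (@orbit_restr _ G _ phi a h).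
- exact: orbit_restr_bij.
- have [g Gg [ex ey]] := hP (sval x) (sval y).
  by exists g => //; split; apply: orbit_type_inj; rewrite (sval_orbit_rep phiP) // (sval_orbit_restr phiP).
exists g => // u Gu.
by rewrite -(sval_orbit_rep phiP (pt u Gu)) // -e (sval_orbit_restr phiP).
Qed.

(** * Coset actions, disjoint unions and regular quotient actions *)

Section CosetRep.
Variables (gT : finGroupType) (G A : {group gT}).

Definition coset_space := {B : {set gT} | B \in rcosets A G}.

(** [insubd] falls back on [x] if the translate leaves the coset space, which cannot happen for [g]
    in [G]. *)
Definition coset_act (g : gT) (x : coset_space) : coset_space :=
  insubd x (val x :* g).

Lemma val_coset_act g x : g \in G -> val (coset_act g x) = val x :* g.
Proof.
move=> Gg; rewrite val_insubd; case: ifP => // /negP[].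
have /rcosetsP[u Gu ->] := valP x.
by rewrite -rcosetM; apply/rcosetsP; exists (u * g); rewrite ?groupM.
Qed.

Lemma coset_act_rep : perm_rep G coset_act.
Proof.
have M x y : x \in G -> y \in G ->
    coset_act (x * y) = coset_act y \o coset_act x.
  move=> Gx Gy; apply/funext=> b; apply: val_inj.
  by rewrite /= !val_coset_act ?groupM // rcosetM.
have act1 b : coset_act 1 b = b.
  by apply: val_inj; rewrite val_coset_act // rcoset1.
split=> [x Gx | x y Gx Gy]; last exact: M.
exists (coset_act x^-1) => b.
  by have /(congr1 (@^~ b)) := M x x^-1 Gx (groupVr Gx); rewrite mulgV act1.
by have /(congr1 (@^~ b)) := M x^-1 x (groupVr Gx) Gx; rewrite mulVg act1.
Qed.

Lemma coset_space_elt (x : coset_space) : exists2 u, u \in G & val x = A :* u.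
Proof. by have /rcosetsP[u Gu ->] := valP x; exists u. Qed.

Lemma coset_act_kernel g :
  g \in G -> (forall x, coset_act g x = x) -> forall u, u \in G -> g \in A :^ u.
Proof.
move=> Gg fixg u Gu.
have Au : A :* u \in rcosets A G by apply/rcosetsP; exists u.
have /(congr1 val) := fixg (Sub (A :* u) Au).
rewrite val_coset_act //= -rcosetM => e.
rewrite mem_conjg conjgE invgK.
have : u * g \in A :* u by rewrite -e rcoset_refl.
by rewrite mem_rcoset mulgA.
Qed.

End CosetRep.

Section SumRep.
Variables (gT : finGroupType) (G : {group gT}) (O1 O2 : Type).
Variables (phi1 : gT -> O1 -> O1) (phi2 : gT -> O2 -> O2).
Hypotheses (phi1P : perm_rep G phi1) (phi2P : perm_rep G phi2).

Definition sum_map (f1 : O1 -> O1) (f2 : O2 -> O2) (x : O1 + O2) : O1 + O2 :=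
  match x with inl a => inl (f1 a) | inr b => inr (f2 b) end.

Lemma sum_map_bij f1 f2 : bijective f1 -> bijective f2 ->
  bijective (sum_map f1 f2).
Proof.
case=> k1 fK1 kK1 [k2 fK2 kK2].
by exists (sum_map k1 k2) => -[a|b] /=; rewrite ?fK1 ?kK1 ?fK2 ?kK2.
Qed.

Lemma sum_rep : perm_rep G (fun x => sum_map (phi1 x) (phi2 x)).
Proof.
split=> [x Gx | x y Gx Gy].
  by apply: sum_map_bij; [apply: phi1P.1 | apply: phi2P.1].
by apply/funext=> -[a|b] /=; rewrite (rep_mul phi1P, rep_mul phi2P).
Qed.

End SumRep.

(** The points are the cosets of [N] in its whole normaliser; the kernel in [G] is still [N]. *)
Lemma regular_quotient_rep (gT : finGroupType) (G N : {group gT}) :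
  N <| G -> perm_rep G (fun g (x : coset_of N) => x * coset N g).
Proof.
case/andP=> _ nNG; split=> [x _ | x y Gx Gy].
  by exists (fun b => b * (coset N x)^-1) => b; rewrite (mulgK, mulgKV).
by apply/funext=> b /=; rewrite morphM ?(subsetP nNG) // mulgA.
Qed.

Lemma rep_faithful (gT : finGroupType) (G : {group gT}) (Omega : Type)
    (phi : gT -> Omega -> Omega) :
  perm_rep G phi -> (forall x, x \in G -> (forall a, phi x a = a) -> x = 1) ->
  {in G &, injective phi}.
Proof.
move=> phiP ker1 x y Gx Gy e; apply/eqP; rewrite eq_mulgV1; apply/eqP.
apply: ker1 => [|a]; first by rewrite groupM ?groupV.
by rewrite (rep_mul phiP) ?groupV // e (repK phiP).
Qed.

Lemma factorisation_coset_pairs (gT : finGroupType) (G A B : {group gT})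
    (x : coset_space G A) (y : coset_space G B) t :
  G \subset A * B -> A \subset G -> B \subset G -> t \in G ->
  exists2 g, g \in G & coset_act t x = coset_act g x /\ y = coset_act g y.
Proof.
move=> sGAB sAG sBG Gt.
have [u Gu eu] := coset_space_elt x; have [v Gv ev] := coset_space_elt y.
have /mulsgP[a b Aa Bb e1] := subsetP sGAB _ (groupM Gu (groupVr Gv)).
have /mulsgP[a' b' Aa' Bb' e2] :=
  subsetP sGAB _ (groupM (groupM Gu Gt) (groupVr Gv)).
have [Ga Gb] := (subsetP sAG a Aa, subsetP sBG b Bb).
have [Ga' Gb'] := (subsetP sAG a' Aa', subsetP sBG b' Bb').
have eu' : u = a * b * v by rewrite -e1 mulgKV.
have eut : u * t = a' * b' * v by rewrite -e2 mulgKV.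
(* The cosets are [A :* (b * v)], its translate [A :* (b' * v)], and [B :* v]: this element carries
   the first to the second and fixes the third. *)
have Gg : (b^-1 * b') ^ v \in G by rewrite groupJ ?groupM ?groupV.
exists ((b^-1 * b') ^ v) => //.
split; apply: val_inj; rewrite !val_coset_act // (eu, ev) -!rcosetM.
  rewrite eut; have -> : u * (b^-1 * b') ^ v = a * a'^-1 * (a' * b' * v).
    by rewrite eu' conjgE !mulgA mulgK mulgK mulgKV.
  by rewrite [RHS]rcosetM (@rcoset_id _ _ (a * a'^-1)) // groupM ?groupV.
by rewrite conjgE mulKVg [RHS]rcosetM (@rcoset_id _ _ (b^-1 * b')) // groupM ?groupV.
Qed.

(** * Consequences of total 2-closure *)

Section Proposition.
Variables (gT : finGroupType) (r : nat) (G : {group gT}) (T : 'I_r -> {group gT}).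
Hypotheses (G_dprod : \big[dprod/1]_(i < r) T i = G)
  (T_simple : forall i, simple (T i)) (T_nonabelian : forall i, ~~ abelian (T i)).

(** The kernel is the normal core of [H <*> 'C_G(T i)]. If it did not centralise [T i] it would
    contain it, and the modular law would put [T i] inside [H]. *)
Lemma coset_act_kernel_centralises (H : {group gT}) i g :
  H \proper T i -> g \in G ->
  (forall x : coset_space G (H <*> 'C_G(T i)), coset_act g x = x) ->
  g \in 'C(T i).
Proof.
set A := (H <*> _)%G => prH Gg /(coset_act_kernel Gg) gA.
have [_ /dprodP[_ eG _ tiTM]] := bigdprod_cofactor G_dprod T_simple T_nonabelian i.
have [sTG _] := andP (factor_normal G_dprod T_simple T_nonabelian i).
have [sHT nsTH] := andP prH; have sHG := subset_trans sHT sTG.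
have sAG : A \subset G by rewrite join_subG sHG subsetIl.
have nsN : gcore A G <| G by rewrite gcore_normal.
case/orP: (normal_factor_dichotomy G_dprod T_simple T_nonabelian i nsN).
  move/subset_trans/(_ (gcore_sub _ _)) => sTA; case/negP: nsTH.
  have eA : A = H * 'C_G(T i) :> {set gT}.
    by rewrite /= cent_joinEr // subIset // (centS sHT) orbT.
  by rewrite -(setIidPl sTA) eA setIC -group_modl // setIC tiTM mulg1.
by move/subsetP; apply; apply/bigcapP.
Qed.

Lemma totally_two_closed_no_factorisation i :
  totally_two_closed G -> ~ has_nontrivial_factorisation (T i).
Proof.
move=> cl [H [K [prH prK eT]]].
have [_ /dprodP[_ eG _ tiTM]] := bigdprod_cofactor G_dprod T_simple T_nonabelian i.
have nsTG := factor_normal G_dprod T_simple T_nonabelian i.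
have [sTG nTG] := andP nsTG.
have sub (L : {group gT}) : L \proper T i -> L <*> 'C_G(T i) \subset G.
  by move=> /proper_sub sLT; rewrite join_subG (subset_trans sLT) // subsetIl.
have [sAG sBG] := (sub H prH, sub K prK).
have sGAB : G \subset (H <*> 'C_G(T i)) * (K <*> 'C_G(T i)).
  by rewrite -{1}eG {1}eT -mulgA mulgSS ?joing_subl // mul_subG ?joing_subl ?joing_subr.
pose Om := (coset_space G (H <*> 'C_G(T i)) + coset_space G (K <*> 'C_G(T i))
  + coset_of (T i))%type.
pose phi12 g := sum_map (@coset_act _ G (H <*> 'C_G(T i)) g)
  (@coset_act _ G (K <*> 'C_G(T i)) g).
pose phi g : Om -> Om := sum_map (phi12 g) (fun x => x * coset (T i) g).
have phi12P : perm_rep G phi12 by apply: sum_rep; apply: coset_act_rep.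
have phiP : perm_rep G phi by apply: sum_rep => //; apply: regular_quotient_rep.
have mem1 g : g \in G -> g \in 'C(T i) ->
    (forall x : coset_of (T i), x * coset (T i) g = x) -> g = 1.
  move=> Gg cg /(_ 1); rewrite mul1g => e.
  apply/set1gP; rewrite -tiTM !inE Gg cg !andbT.
  by apply: coset_idr e; apply: (subsetP nTG).
have inj_phi : {in G &, injective phi}.
  apply: rep_faithful => // g Gg fixg; apply: mem1 => // [|x].
    by apply: coset_act_kernel_centralises prH Gg _ => x; have [] := fixg (inl (inl x)).
  by have [] := fixg (inr x).
have [t Tt nt1] : exists2 t, t \in T i & t != 1.
  by apply/trivgPn; case/simpleP: (T_simple i).
have Gt := subsetP sTG t Tt.
pose h : Om -> Om := sum_map (sum_map (coset_act t) id) id.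
have ct x : x * coset (T i) t = x by rewrite coset_id ?mulg1.
have /(two_closedE phiP) clG := cl _ _ phiP inj_phi.
have phi1 z : phi 1 z = z := rep_one phiP z.
have [||g Gg eh] := clG h.
- apply: sum_map_bij; last by exists id.
  by apply: sum_map_bij; [apply: (coset_act_rep G _).1 | exists id].
(* Since [t] acts trivially on the third orbit, [t] serves unless the second orbit is involved;
   pairs avoiding the first orbit take [1], and pairs mixing the first two use the factorisation. *)
- move=> [[x|x]|x] [[y|y]|y].
  + by exists t.
  + have [g Gg [ex ey]] := factorisation_coset_pairs x y sGAB sAG sBG Gt.
    by exists g => //; rewrite /= ex -ey.
  + by exists t; rewrite //= ct.
  + have [g Gg [ex ey]] := factorisation_coset_pairs y x sGAB sAG sBG Gt.
    by exists g => //; rewrite /= ex -ey.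
  + by exists 1; rewrite ?phi1.
  + by exists 1; rewrite ?phi1.
  + by exists t; rewrite //= ct.
  + by exists 1; rewrite ?phi1.
  + by exists 1; rewrite ?phi1.
have ehz z : h z = phi g z by rewrite eh.
(* Here [g] fixes the second and third orbits, which already form a faithful action. Then [t] fixes
   the first orbit too, and the first and third force [t = 1]. *)
have g1 : g = 1.
  apply: mem1 => // [|x].
    by apply: coset_act_kernel_centralises prK Gg _ => x; have [] := ehz (inl (inr x)).
  by have [] := ehz (inr x).
case/eqP: nt1; apply: mem1 => //.
apply: coset_act_kernel_centralises prH Gt _ => x; have [->] := ehz (inl (inl x)).
by rewrite g1 (rep_one (coset_act_rep G _)).
Qed.

Lemma totally_two_closed_image (Omega : Type) (phi : gT -> Omega -> Omega) :
  totally_two_closed G -> perm_rep G phi ->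
  two_closure (rep_image G phi) = rep_image G phi.
Proof.
move=> cl phiP; apply/(two_closedE phiP) => h bij_h hP.
pose N := [set x in G | `[< forall a, phi x a = a >]].
have NP x : reflect (x \in G /\ forall a, phi x a = a) (x \in N).
  by rewrite inE; apply: (iffP andP) => -[Gx /asboolP].
have gN : group_set N.
  apply/group_setP; split=> [|x y /NP[Gx xP] /NP[Gy yP]]; apply/NP; split=> //.
  - by move=> a; rewrite (rep_one phiP).
  - exact: groupM.
  - by move=> a; rewrite (rep_mul phiP) // xP yP.
have nsN : Group gN <| G.
  apply/andP; split; first by apply/subsetP=> x /NP[].
  apply/subsetP=> z Gz; rewrite inE; apply/subsetP=> _ /imsetP[y /NP[Gy yP] ->].
  apply/NP; split=> [|a]; first exact: groupJ.
  by rewrite conjgE !(rep_mul phiP) ?groupM ?groupV // yP (repVK phiP).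
have defG := normal_dprod_cent G_dprod T_simple T_nonabelian nsN.
have [_ nsC] := direct_factor_normal defG.
case/dprodP: defG => _ eG _ tiNC.
pose C := 'C_G(Group gN)%G.
pose psi g : (Omega + coset_of C)%type -> (Omega + coset_of C)%type :=
  sum_map (phi g) (fun x : coset_of C => x * coset C g).
have psiP : perm_rep G psi by apply: sum_rep => //; apply: regular_quotient_rep.
have inj_psi : {in G &, injective psi}.
  apply: rep_faithful => // g Gg fixg; apply/set1gP; rewrite -tiNC inE.
  apply/andP; split.
    by apply/NP; split=> // a; have [] := fixg (inl a).
  have fixC (x : coset_of C) : x * coset C g = x by have [] := fixg (inr x).
  have e : coset C g = 1 by rewrite -[LHS]mul1g fixC.
  by apply: coset_idr e; apply: (subsetP (normal_norm nsC)).
(* As [G] is [N] times [C], any [g] may be replaced by an element of [C], which fixes all the added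
   points. *)
have toC g : g \in G -> exists2 c, c \in C & phi c =1 phi g.
  rewrite -{1}eG => /mulsgP[n c /NP[Gn nP] Cc ->]; exists c => // a.
  by rewrite (rep_mul phiP) ?nP //; case/setIP: Cc.
have cP g : g \in G -> exists2 c, c \in G &
    phi c =1 phi g /\ forall x : coset_of C, x * coset C c = x.
  case/toC=> c Cc e; exists c; first by case/setIP: Cc.
  by split=> // x; rewrite coset_id ?mulg1.
have /(two_closedE psiP) clG := cl _ _ psiP inj_psi.
have [||g Gg eh] := clG (sum_map h id).
- by apply: sum_map_bij => //; exists id.
- move=> [x|x] [y|y].
  + have [g Gg [ex ey]] := hP x y; have [c Gc [ec _]] := cP g Gg.
    by exists c; rewrite //= !ec ex ey.
  + have [g Gg [ex _]] := hP x x; have [c Gc [ec cx]] := cP g Gg.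
    by exists c; rewrite //= !ec ex cx.
  + have [g Gg [ex _]] := hP y y; have [c Gc [ec cx]] := cP g Gg.
    by exists c; rewrite //= !ec ex cx.
  + by exists 1; rewrite ?(rep_one psiP).
exists g => //; apply/funext=> a.
by have := congr1 (@^~ (inl a)) eh; case.
Qed.

End Proposition.

(** * The equivalence, with the gluing argument for sufficiency *)

Theorem proposition2p10 (gT : finGroupType) (r : nat) (G : {group gT})
    (T : 'I_r -> {group gT})
    (r_ge1 : (1 <= r)%N)
    (G_dprod : \big[dprod/1]_(i < r) T i = G)
    (T_simple : forall i, simple (T i))
    (T_nonabelian : forall i, ~~ abelian (T i))
    (T_nsection : forall i,
      ~ is_section_of (T i) (\big[dprod/1]_(j < r | j != i) T j)) :
  totally_two_closed G <->
  (forall i, ~ has_nontrivial_factorisation (T i)) /\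
  (forall (Omega : Type) (phi : gT -> Omega -> Omega),
     perm_rep G phi ->
     (exists a b : Omega, a <> b) ->
     transitive_on (rep_image G phi) ->
     two_closure (rep_image G phi) = rep_image G phi).
Proof.
split=> [cl | [T_nfact cl] Omega phi phiP _].
  split=> [i | Omega phi phiP _ _].
    exact: (totally_two_closed_no_factorisation G_dprod T_simple T_nonabelian).
  exact: (totally_two_closed_image G_dprod T_simple T_nonabelian).
apply/(two_closedE phiP) => h bij_h hP.
have [|f fP] := @choice _ _ (fun a g => g \in G /\
    forall u, u \in G -> h (phi u a) = phi g (phi u a)).
  by move=> a; have [g Gg gP] := agree_on_orbit a phiP cl bij_h hP; exists g.
have Gf a : f a \in G by case: (fP a).
have compat i a b : ~~ (T i \subset stab G phi a) ->
    ~~ (T i \subset stab G phi b) -> f a * (f b)^-1 \in 'C(T i).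
  move=> nTa nTb.
  apply: (@mem_all_conj_products _ _ _ _ G_dprod T_simple T_nonabelian
    T_nfact T_nsection (stab_group phiP a) (stab_group phiP b));
    rewrite ?stab_sub ?groupM ?groupV // => u v Gu Gv.
  (* On the first point [g] agrees with [f a], on the second with [f b], so the two quotients lie in
     the conjugated stabilisers. *)
  have [g Gg [ea eb]] := hP (phi u a) (phi v b).
  have -> : f a * (f b)^-1 = (g * (f a)^-1)^-1 * (g * (f b)^-1).
    by rewrite invMg invgK -!mulgA mulKg.
  have mem c w : w \in G -> h (phi w c) = phi g (phi w c) ->
      g * (f c)^-1 \in stab_group phiP c :^ w.
    move=> Gw ec; apply: (mem_stab_conj phiP) => //.
      by rewrite groupM ?groupV.
    by rewrite (rep_mul phiP) ?groupV // -ec (fP c).2 // (repK phiP).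
  by rewrite mem_mulg ?groupV; [| exact: mem | exact: mem].
(* [c i] carries the common [T i]-component of all [f a] with [T i] not fixing [a]; it is [1] if
   there is no such [a]. *)
have [|c cP] := @choice _ _ (fun i g => g \in G /\
    forall a, ~~ (T i \subset stab G phi a) -> f a * g^-1 \in 'C(T i)).
  move=> i; have [[a nTa] | triv] :=
    pselect (exists a, ~~ (T i \subset stab G phi a)).
    by exists (f a); split=> // b nTb; apply: compat.
  by exists 1; split=> // a nTa; case: triv; exists a.
have [g Gg gP] := glue_components G_dprod T_simple T_nonabelian
  (fun i => (cP i).1).
exists g => //; apply/funext=> a.
(* A factor outside the core is outside the stabiliser, as factors are normal; there [f a] and [g]
   have equal components. So [f a * g^-1] fixes [a]. *)
have : f a * g^-1 \in gcore (stab_group phiP a) G.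
  apply: (mem_normal_by_factors G_dprod T_simple T_nonabelian).
  - by rewrite gcore_normal ?stab_sub.
  - by rewrite groupM ?groupV.
  move=> i nTN.
  have nTa : ~~ (T i \subset stab G phi a).
    apply: contra nTN => sTa.
    have [_ nTG] := andP (factor_normal G_dprod T_simple T_nonabelian i).
    by rewrite gcore_max.
  have -> : f a * g^-1 = f a * (c i)^-1 * (g * (c i)^-1)^-1.
    by rewrite invMg invgK mulgA mulgKV.
  by rewrite groupM ?groupV // (cP i).2.
move/(subsetP (gcore_sub _ _)) => /stabP[_ e].
have := (fP a).2 1 (group1 G); rewrite (rep_one phiP) => ->.
by rewrite -[X in _ = phi g X]e -(rep_mul phiP) ?groupM ?groupV // mulgKV.
Qed.
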